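(* Let $N=\lfloor (K+2)/2\rfloor$ and $$q_J(u)=\Big(\frac1N\sum_{j=0}^{N-1}u^j\Big)^2$$ (the squared Fejér/Jackson kernel, $\deg q_J=2N-2\le K$, $q_J(1)=1$). For every rotation spectrum with resolvent $L$ and floor $s=\operatorname{dist}(1,\sigma(L))$, and every $y_0$, the point $y_K=q_J(L)y_0$ satisfies $$\|r(y_K)\|\ \le\ \frac{4\,d_0}{N^2s}\ \le\ \frac{16\,d_0}{(K+1)^2s}.$$ In particular, $\|r(y_K)\|=o(d_0/K)$ whenever $sK\to\infty$, and $q_J$ improves on the universal envelope $1/(K+1)$ as soon as $s\gtrsim 16/(K+1)$.
   Context: $K$ is the number of resolvent evaluations. A rotation spectrum means: the real Hilbert space is an orthogonal direct sum of planes $\mathbb{R}^2\cong\mathbb{C}$, and the resolvent $L=(I+M)^{-1}$ of the maximal monotone operator $M$ acts on each plane as multiplication by $\zeta(\theta)=\cos\theta\,e^{i\theta}=\frac{1+e^{2i\theta}}2$ for some angle $\theta\in(0,\pi)$ depending on the plane. Since $|\zeta(\theta)-1|=\sin\theta$, the spectral floor is $s=\operatorname{dist}(1,\sigma(L))=\inf_\theta\sin\theta$, the infimum over the angles of the spectrum. $r(y)=Ly-y$ is the fixed-point residual; $d_0$ is the distance of $y_0$ to the zero set of $M$ (here $\{0\}$, so $d_0=\|y_0\|$). The universal envelope is the residual bound $d_0/(K+1)$ (that is, $1/(K+1)$ for $d_0=1$), which the averaged-reflection point $\frac1{K+1}\sum_{j=0}^K(2J-I)^jy_0$, $J$ the resolvent,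 satisfies for every maximal monotone operator. *)

(* Defs.v *)
From HB Require Import structures.
From mathcomp Require Import all_boot all_order all_algebra.
From mathcomp Require Import sesquilinear.
From mathcomp Require Import complex.
From mathcomp Require Import all_classical all_reals all_analysis.

Set Implicit Arguments.
Unset Strict Implicit.
Unset Printing Implicit Defensive.

Import Order.TTheory GRing.Theory Num.Theory.
Import numFieldNormedType.Exports.

Local Open Scope classical_set_scope.
Local Open Scope ring_scope.

Record real_hilbert (R : realType) := RealHilbert {
  hilbert_sort :> completeNormedModType R;
  dotp : {dot hilbert_sort for idfun};
  dotp_norm : forall x : hilbert_sort, dotp x x = `|x| ^+ 2
}.

Section Operators.
Variables (R : realType) (H : real_hilbert R).
Implicit Types (M : H -> set H) (L : H -> H).

(* A set-valued operator M is identified with its graph { (x, u) | u in M x }. *)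
Definition monotone_op M : Prop :=
  forall x y u v, M x u -> M y v -> 0 <= dotp H (x - y) (u - v).

Definition maximal_monotone M : Prop :=
  monotone_op M /\
  forall M', monotone_op M' -> (forall x, M x `<=` M' x) ->
    forall x, M' x `<=` M x.

Definition zeros M : set H := [set x | M x 0].

(* L = (I + M)^-1, everywhere defined and single-valued:
   L x = y iff x is in y + M y. *)
Definition is_resolvent M L : Prop :=
  forall x y, L x = y <-> M y (x - y).

Definition dist_to (x : H) (A : set H) : R := inf [set `|x - z| | z in A].

(* L - l on the complexification H + iH of H, a vector x + iy being encoded
   as the pair (x, y). *)
Definition complexified_sub L (l : R[i]) (p : H * H) : H * H :=
  (L p.1 - (complex.Re l *: p.1 - complex.Im l *: p.2),
   L p.2 - (complex.Im l *: p.1 + complex.Re l *: p.2)).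

(* The resolvent set consists of the l for which L - l has a continuous
   everywhere defined inverse on the complexification. *)
Definition spectrum L : set R[i] :=
  [set l | ~ exists g : H * H -> H * H,
      [/\ continuous g,
          cancel (complexified_sub L l) g &
          cancel g (complexified_sub L l)]].

(* dist(1, spectrum L); on the zero space the spectrum is empty and this inf is
   0 by convention rather than +oo. *)
Definition spectral_floor L : R :=
  inf [set complex.Re `|1 - l| | l in spectrum L].

Definition residual L (y : H) : H := L y - y.

Definition poly_op L (q : {poly R}) (y : H) : H :=
  \sum_(k < size q) q`_k *: iter k L y.

End Operators.

Definition zeta (R : realType) (t : R) : R[i] :=
  (cos t)%:C%C * (cos t +i* sin t)%C.

(* The planes are given as isometric embeddings [plane i] of C, with the real
   inner product Re (z w^* ), into H; preservation of the inner product makes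
   [plane i] R-linear.  Their Hilbert direct sum is H: they are pairwise
   orthogonal and the finite sums of their elements are dense. *)
Record rotation_spectrum (R : realType) := RotationSpectrum {
  rs_space :> real_hilbert R;
  rs_op : rs_space -> set rs_space;
  rs_res : {linear rs_space -> rs_space};
  rs_opP : maximal_monotone rs_op;
  rs_resP : is_resolvent rs_op rs_res;
  rs_index : Type;
  rs_angle : rs_index -> R;
  rs_angleP : forall i, 0 < rs_angle i < pi;
  rs_plane : rs_index -> R[i] -> rs_space;
  rs_plane_isom : forall i z w,
    dotp rs_space (rs_plane i z) (rs_plane i w) = complex.Re (z * w^*);
  rs_plane_ortho : forall i j z w, i <> j ->
    dotp rs_space (rs_plane i z) (rs_plane j w) = 0;
  rs_plane_dense :
    dense (range (fun s : seq (rs_index * R[i]) =>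
                    \sum_(p <- s) rs_plane p.1 p.2));
  rs_res_plane : forall i z,
    rs_res (rs_plane i z) = rs_plane i (zeta (rs_angle i) * z)
}.

Section Kernel.
Variable R : realType.

Definition rs_floor (S : rotation_spectrum R) : R := spectral_floor (rs_res S).

Definition rs_d0 (S : rotation_spectrum R) (y0 : S) : R :=
  dist_to y0 (zeros (@rs_op R S)).

Definition jackson_N (K : nat) : nat := ((K + 2) %/ 2)%N.

Definition jackson_poly (K : nat) : {poly R} :=
  ((jackson_N K)%:R^-1 *: \sum_(j < jackson_N K) 'X^j) ^+ 2.

Definition jackson_point (S : rotation_spectrum R) (K : nat) (y0 : S) : S :=
  poly_op (rs_res S) (jackson_poly K) y0.

Definition jackson_residual (S : rotation_spectrum R) (K : nat) (y0 : S) : R :=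
  `|residual (rs_res S) (jackson_point K y0)|.

Definition universal_envelope (K : nat) (d0 : R) : R := d0 / K.+1%:R.

End Kernel.

(* Main.v *)
(* On each plane [u -> (u - 1) q_J(u)] acts as multiplication by
   [(zeta^N - 1)^2 / (N^2 (zeta - 1))], since [(u - 1)(1 + ... + u^(N-1)) = u^N - 1].
   Each [zeta] is an eigenvalue of the complexified resolvent, so [|zeta - 1| >= s],
   and [|zeta|^2 + |zeta - 1|^2 = 1] gives [|zeta^N - 1| <= 1 + sqrt(1 - s^2) < 2];
   the strictness here is what makes the comparison with the envelope strict.
   Multiplier bounds pass to norm bounds on finite sums by orthogonality, then to
   the whole space by density; applied to [s <= |zeta - 1|] they also show that
   the zero set is [{0}]. *)
Require Import Defs.
From HB Require Import structures.
From mathcomp Require Import all_boot all_order all_algebra.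
From mathcomp Require Import sesquilinear complex zify ring lra.
From mathcomp Require Import all_classical all_reals all_analysis.
Import Order.TTheory GRing.Theory Num.Theory.
Import numFieldNormedType.Exports.
Local Open Scope classical_set_scope.
Local Open Scope ring_scope.

(** * Resolvents and polynomials of a linear operator on a Hilbert space *)

Section HilbertSpace.
Variables (R : realType) (H : real_hilbert R).
Implicit Types (x y : H) (L : {linear H -> H}) (q : {poly R}).

Lemma dotp_eq0 x : dotp H x x = 0 -> x = 0.
Proof. by rewrite dotp_norm => /eqP; rewrite sqrf_eq0 normr_eq0 => /eqP. Qed.

Lemma dotp_sum (I : Type) (s : seq I) (F : I -> H) :
  dotp H (\sum_(a <- s) F a) (\sum_(b <- s) F b) =
  \sum_(a <- s) \sum_(b <- s) dotp H (F a) (F b).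
Proof. by rewrite linear_sumlz; apply: eq_bigr => a _; rewrite linear_sumr. Qed.

(** Monotonicity between the graph points [(L x, x - L x)] and [(0, 0)] makes the inner product of
    [L x] and [x - L x] nonnegative; expanding the squared norm of their sum [x] then leaves at
    least [|L x|^2]. *)
Lemma resolvent_nonexpansive (M : H -> set H) L : monotone_op M ->
  is_resolvent M L -> forall x, `|L x| <= `|x|.
Proof.
move=> monM resL x.
have ML y : M (L y) (y - L y) by apply/resL.
have := monM _ _ _ _ (ML x) (ML 0).
rewrite linear0 !subr0 => ge0.
rewrite -ler_sqr ?nnegrE // -!dotp_norm.
rewrite -{3 4}[x](subrK (L x)) [x - L x + _]addrC.
move: (L x) (x - L x) ge0 => u v ge0.
have := sqr_ge0 `|v|; rewrite -dotp_norm !(linearDl, linearDr) /=.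
by rewrite (hermC (dotp H) v u) /= expr0 mul1r; lra.
Qed.

Lemma linear_nonexpansive_continuous L :
  (forall x, `|L x| <= `|x|) -> continuous L.
Proof.
move=> Lle; apply/linear_bounded_continuous/bounded_funP => r.
by exists r => x; apply/le_trans.
Qed.

Lemma poly_op_continuous L q : continuous L -> continuous (poly_op L q).
Proof.
move=> Lc; rewrite /poly_op.
apply: continuous_big => [|k _ x]; first exact: add_continuous.
apply: cvgZl_tmp.
elim: (nat_of_ord k) x => [|n IH] x /=; first exact: cvg_id.
exact: (continuous_comp (IH x) (Lc _)).
Qed.

Lemma poly_op_is_linear L q : linear (poly_op L q).
Proof.
move=> c x y; rewrite /poly_op scaler_sumr -big_split; apply: eq_bigr => k _ /=.
have -> n : iter n L (c *: x + y) = c *: iter n L x + iter n L y.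
  by elim: n => //= n ->; rewrite linearP.
by rewrite scalerDr !scalerA mulrC.
Qed.

HB.instance Definition _ L q :=
  GRing.isLinear.Build R H H *:%R (poly_op L q) (poly_op_is_linear L q).

Lemma residual_is_linear L : linear (residual L).
Proof.
by move=> c x y; rewrite /residual linearP scalerBr opprD addrACA.
Qed.

HB.instance Definition _ L :=
  GRing.isLinear.Build R H H *:%R (residual L) (residual_is_linear L).

End HilbertSpace.

(** * Moduli of complex multipliers *)

Section ComplexModulus.
Variable R : realType.
Implicit Types z w : R[i].
Local Notation normc := (@Normc.normc R).

Lemma sqr_normc_ReIm z : normc z ^+ 2 = complex.Re z ^+ 2 + complex.Im z ^+ 2.
Proof. by case: z => a b /=; rewrite sqr_sqrtr ?addr_ge0 ?sqr_ge0. Qed.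

Lemma normc_ge0 z : 0 <= normc z.
Proof. by case: z => a b /=; exact: sqrtr_ge0. Qed.

Lemma normcX z n : normc (z ^+ n) = normc z ^+ n.
Proof.
elim: n => [|n IH]; first by rewrite !expr0 Normc.normc1.
by rewrite !exprS Normc.normcM IH.
Qed.

Lemma normc_real (a : R) : normc a%:C%C = `|a|.
Proof. by rewrite /= expr0n addr0 sqrtr_sqr. Qed.

Lemma ler_normcB z w : normc (z - w) <= normc z + normc w.
Proof. by have := le_normcD z (- w); rewrite normcN. Qed.

(** Multiplication by [a] is a similarity of ratio [|a|]. *)
Lemma Re_mul_conj_scale a z w :
  complex.Re (a * z * (a * w)^*) = normc a ^+ 2 * complex.Re (z * w^*).
Proof.
rewrite sqr_normc_ReIm; case: a z w => [a1 a2] [z1 z2] [w1 w2] /=; ring.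
Qed.

(** By Thales: [zeta t] lies on the circle with diameter [[0, 1]], so this is Pythagoras with
    hypotenuse 1. *)
Lemma normc_zeta (t : R) :
  normc (zeta t) ^+ 2 + normc (zeta t - 1) ^+ 2 = 1.
Proof.
rewrite !sqr_normc_ReIm /= -[RHS](cos2Dsin2 t).
have : cos t ^+ 2 * (cos t ^+ 2 + sin t ^+ 2) = cos t ^+ 2.
  by rewrite cos2Dsin2 mulr1.
by have := cos2Dsin2 t; lra.
Qed.

End ComplexModulus.

(** * Operators acting by a multiplier on each plane, and the spectrum *)

Section RotationSpectrum.
Variables (R : realType) (S : rotation_spectrum R).
Local Notation normc := (@Normc.normc R).
Local Notation P := (@rs_plane R S).
Local Notation L := (rs_res S).
Local Notation z_ i := (zeta (rs_angle i)).
Implicit Types (i : rs_index S) (z w : R[i]).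

(** The squared norm of the difference of the two sides expands into inner products of plane
    vectors; the isometry evaluates them all, and they cancel. *)
Lemma rs_plane_linear i (a b : R) z w :
  P i (a%:C%C * z + b%:C%C * w) = a *: P i z + b *: P i w.
Proof.
apply/subr0_eq/dotp_eq0.
rewrite !(linearDl, linearDr, linearNl, linearNr, linearZl_LR, linearZr_LR) /=.
rewrite !rs_plane_isom; case: z w => [z1 z2] [w1 w2] /=.
rewrite /GRing.scale /=; ring.
Qed.

Lemma rs_plane0 i : P i 0 = 0.
Proof. by apply: dotp_eq0; rewrite rs_plane_isom mul0r. Qed.

Lemma rs_planeD i z w : P i (z + w) = P i z + P i w.
Proof. by have := rs_plane_linear i 1 1 z w; rewrite !mul1r !scale1r. Qed.

Lemma rs_planeZ i (a : R) z : P i (a%:C%C * z) = a *: P i z.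
Proof.
by have := rs_plane_linear i a 0 z 0; rewrite mulr0 rs_plane0 scaler0 !addr0.
Qed.

Definition acts_by (A : S -> S) (a : rs_index S -> R[i]) :=
  forall i z, A (P i z) = P i (a i * z).

(* Choosing [c i] with [|a i|^2 + |c i|^2 = |b i|^2] turns the comparison into
   an exact identity of double sums, so repeated indices need not be grouped. *)
Lemma acts_by_le_sum (A B : {linear S -> S}) a b :
    acts_by A a -> acts_by B b ->
    (forall i, normc (a i) <= normc (b i)) ->
  forall s : seq (rs_index S * R[i]),
    `|A (\sum_(p <- s) P p.1 p.2)| <= `|B (\sum_(p <- s) P p.1 p.2)|.
Proof.
move=> Aa Bb ab s.
pose c i : R[i] := (Num.sqrt (normc (b i) ^+ 2 - normc (a i) ^+ 2))%:C%C.
have cE i : normc (a i) ^+ 2 + normc (c i) ^+ 2 = normc (b i) ^+ 2.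
  rewrite normc_real real_normK ?num_real // sqr_sqrtr ?subrKC //.
  by rewrite subr_ge0 ler_sqr ?nnegrE ?normc_ge0.
rewrite -ler_sqr ?nnegrE // !linear_sum /=.
under eq_bigr do rewrite Aa; under [in leRHS]eq_bigr do rewrite Bb.
rewrite -!dotp_norm.
rewrite -[leLHS]addr0.
have <- : dotp S (\sum_(p <- s) P p.1 (a p.1 * p.2))
                (\sum_(p <- s) P p.1 (a p.1 * p.2)) +
         dotp S (\sum_(p <- s) P p.1 (c p.1 * p.2))
                (\sum_(p <- s) P p.1 (c p.1 * p.2)) =
         dotp S (\sum_(p <- s) P p.1 (b p.1 * p.2))
                (\sum_(p <- s) P p.1 (b p.1 * p.2)).
  rewrite !dotp_sum -big_split; apply: eq_bigr => -[i z] _ /=.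
  rewrite -big_split; apply: eq_bigr => -[j w] _ /=.
  have [<-|ij] := pselect (i = j); last by rewrite !rs_plane_ortho ?addr0.
  by rewrite !rs_plane_isom !Re_mul_conj_scale -mulrDl cE.
by rewrite lerD2l dotp_norm sqr_ge0.
Qed.

(** A strict violation at [x] would persist on a nonempty open set, which contains a finite sum of
    plane vectors by density. *)
Lemma acts_by_le (A B : {linear S -> S}) a b :
    acts_by A a -> acts_by B b ->
    (forall i, normc (a i) <= normc (b i)) ->
    continuous A -> continuous B ->
  forall x, `|A x| <= `|B x|.
Proof.
move=> Aa Bb ab Ac Bc x; rewrite leNgt; apply/negP => ltx.
pose f y := `|A y| - `|B y|.
have fc : continuous f.
  move=> y; apply: cvgB; apply: cvg_norm; [exact: Ac | exact: Bc].
have [||y [/= fy [s _ sy]]] := @rs_plane_dense R S (f @^-1` [set r | 0 < r]).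
- by exists x; rewrite /= subr_gt0.
- by apply: open_comp => // ? _; exact: fc.
by move: fy; rewrite subr_gt0 ltNge -sy (acts_by_le_sum _ _ _ _ Aa Bb ab).
Qed.

Lemma res_nonexpansive (x : S) : `|L x| <= `|x|.
Proof.
have [monM _] := @rs_opP R S. apply: (resolvent_nonexpansive _ _ _ _ monM (@rs_resP R S)).
Qed.

Lemma res_continuous : continuous L.
Proof. exact/linear_nonexpansive_continuous/res_nonexpansive. Qed.

Lemma residual_continuous : continuous (residual L).
Proof. by move=> x; apply: cvgB; [exact: res_continuous | exact: cvg_id]. Qed.

Lemma residual_acts_by : acts_by (residual L) (fun i => z_ i - 1).
Proof.
move=> i z; rewrite /residual rs_res_plane mulrBl mul1r rs_planeD.
by rewrite -mulN1r -[-1](rmorphN1 (real_complex R)) rs_planeZ scaleN1r.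
Qed.

Lemma poly_op_acts_by (q : {poly R}) :
  acts_by (poly_op L q) (fun i => (map_poly (real_complex R) q).[z_ i]).
Proof.
move=> i z; rewrite /poly_op.
have iterL n : iter n L (P i z) = P i (z_ i ^+ n * z).
  elim: n => [|n IH]; first by rewrite expr0 mul1r.
  by rewrite iterS IH rs_res_plane mulrA -exprS.
(* [P i] is a bare function without a linear structure, so additivity is extended to finite sums by
   induction. *)
have planeS (n : nat) (F : nat -> R[i]) :
    P i (\sum_(k < n) F k) = \sum_(k < n) P i (F k).
  elim: n => [|n IH]; first by rewrite !big_ord0 rs_plane0.
  by rewrite !big_ord_recr /= rs_planeD IH.
rewrite horner_coef size_map_poly mulr_suml.
rewrite (planeS _ (fun k => (map_poly (real_complex R) q)`_k * z_ i ^+ k * z)).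
by apply: eq_bigr => k _; rewrite iterL coef_map -mulrA rs_planeZ.
Qed.

(* [(P 1, P (-i))] is an eigenvector of the complexified resolvent. *)
Lemma zeta_spectrum i : spectrum L (z_ i).
Proof.
move=> [g [_ gK _]].
pose u := P i 1; pose v := P i (0 +i* -1)%C.
have uE l : P i (l * 1) = complex.Re l *: u - complex.Im l *: v.
  rewrite -scaleNr -rs_plane_linear; congr (P i); apply/eqP.
  by case: l => a b; rewrite eq_complex /=; apply/andP; split; apply/eqP; ring.
have vE l : P i (l * (0 +i* -1)%C) = complex.Im l *: u + complex.Re l *: v.
  rewrite -rs_plane_linear; congr (P i); apply/eqP.
  by case: l => a b; rewrite eq_complex /=; apply/andP; split; apply/eqP; ring.
(* With [v] the image of [-i], [L] acts on [(u, v)] as the complex scalar [zeta]. A left inverse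
   would then force [u = 0], although [|u|^2 = 1]. *)
have ker0 : complexified_sub L (z_ i) (u, v) = 0.
  by rewrite /complexified_sub !rs_res_plane uE vE !subrr.
have ker00 : complexified_sub L (z_ i) (0 : S, 0 : S) = 0.
  by rewrite /complexified_sub /= !(linear0, scaler0, addr0, subr0).
have [/(congr1 (fun x => dotp S x x))] : (u, v) = (0 : S, 0 : S).
  by rewrite -(gK (u, _)) -(gK (0, _)) ker0 ker00.
by rewrite rs_plane_isom linear0l /= mulr1 mul0r subr0 => /eqP; rewrite oner_eq0.
Qed.

Lemma rs_floor_le i : rs_floor S <= normc (z_ i - 1).
Proof.
rewrite -normcN opprB; apply: ge_inf; last by exists (z_ i) => //; exact: zeta_spectrum.
by exists 0 => _ [l _ <-]; exact: normc_ge0.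
Qed.

(** Comparing with a homothety turns a uniform bound on multipliers into a bound on norms. *)
Lemma scale_acts_by (c : R) : acts_by ( *:%R c) (fun=> c%:C%C).
Proof. by move=> i z; rewrite -rs_planeZ. Qed.

Lemma scale_continuous (c : R) : continuous ( *:%R c : S -> S).
Proof. by move=> x; apply: cvgZl_tmp; exact: cvg_id. Qed.

(** * Consequences of a positive floor: zero set and residual bound *)

Section PositiveFloor.
Local Notation s := (rs_floor S).
Hypothesis s_gt0 : 0 < s.

Lemma residual_ge (x : S) : s * `|x| <= `|residual L x|.
Proof.
rewrite -{1}(gtr0_norm s_gt0) -normrZ.
apply: (acts_by_le (GRing.scale s) (residual L) _ _
  (scale_acts_by s) residual_acts_by _ (scale_continuous s) residual_continuous).
by move=> i; rewrite normc_real gtr0_norm // rs_floor_le.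
Qed.

(** Zeros of the operator are fixed points of [L]; there the residual vanishes, and it dominates
    [s * |x|]. *)
Lemma rs_zerosE : zeros (@rs_op R S) = [set 0].
Proof.
have zeroP x : zeros (@rs_op R S) x <-> L x = x.
  by rewrite (@rs_resP R S x x) subrr.
apply/seteqP; split=> [x /zeroP Lx | _ ->]; last by apply/zeroP; rewrite linear0.
have := residual_ge x; rewrite /residual Lx subrr normr0.
by rewrite pmulr_rle0 // normr_le0 => /eqP.
Qed.

Lemma rs_d0E (y : S) : rs_d0 y = `|y|.
Proof. by rewrite /rs_d0 /dist_to rs_zerosE image_set1 subr0 inf1. Qed.

(** The largest modulus that [|zeta|^2 + |zeta - 1|^2 = 1] allows once [|zeta - 1| >= s]. *)
Definition contraction : R := Num.sqrt (1 - s ^+ 2).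

Lemma contraction_lt1 : contraction < 1.
Proof.
rewrite -[ltRHS]sqrtr1 ltr_sqrt ?ltr01 //.
by rewrite ltrBlDr ltrDl exprn_gt0.
Qed.

Lemma normc_zeta_le i : normc (z_ i) <= contraction.
Proof.
rewrite -[leLHS]ger0_norm ?normc_ge0 // -sqrtr_sqr ler_wsqrtr //.
rewrite -(normc_zeta _ (rs_angle i)) -addrA lerDl subr_ge0.
by rewrite ler_sqr ?nnegrE ?normc_ge0 ?rs_floor_le // ltW.
Qed.

Lemma jackson_multiplier_le (K : nat) i :
  normc ((z_ i - 1) * (map_poly (real_complex R) (jackson_poly R K)).[z_ i])
    <= (1 + contraction) ^+ 2 / ((jackson_N K)%:R ^+ 2 * s).
Proof.
set N := jackson_N K; set m := normc _.
have N_gt0 : (0 < N)%N by rewrite /N /jackson_N divn_gt0 // addn2.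
pose d := normc (z_ i - 1).
have d_gt0 : 0 < d by apply: lt_le_trans (rs_floor_le i).
(* Of the two factors [(zeta^N - 1) / (zeta - 1)] in the squared kernel, one loses its denominator
   to the residual factor [zeta - 1]; a single [d] remains. *)
have mE : m * (N%:R ^+ 2 * d) = normc (z_ i ^+ N - 1) ^+ 2.
  rewrite /m /jackson_poly -/N rmorphXn /= map_polyZ rmorph_sum /=.
  under eq_bigr do rewrite map_polyXn.
  rewrite horner_exp hornerZ horner_sum.
  under eq_bigr do rewrite hornerXn.
  rewrite subrX1 !(Normc.normcM, normcX) normc_real.
  rewrite ger0_norm ?invr_ge0 ?ler0n //.
  by rewrite -/d; field; rewrite pnatr_eq0 -lt0n.
rewrite ler_pdivlMr ?mulr_gt0 ?exprn_gt0 ?ltr0n //.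
apply: (@le_trans _ _ (normc (z_ i ^+ N - 1) ^+ 2)).
  rewrite -mE ler_wpM2l ?normc_ge0 // ler_wpM2l ?sqr_ge0 //.
  exact: rs_floor_le.
rewrite ler_sqr ?nnegrE ?normc_ge0 ?addr_ge0 ?sqrtr_ge0 //.
rewrite (le_trans (ler_normcB _ _ _)) // Normc.normc1 addrC lerD2l normcX.
(* Since [N >= 1] and [|zeta| < 1], the power satisfies [|zeta|^N <= |zeta|]; the bound is thus
   uniform in [N]. *)
apply: le_trans (normc_zeta_le i).
rewrite -[leRHS]expr1 ler_wiXn2l ?normc_ge0 //.
exact/ltW/(le_lt_trans (normc_zeta_le i))/contraction_lt1.
Qed.

(** The factor [(1 + contraction)^2] is kept instead of 4 so that both the weak and the strict rate
    follow. *)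
Lemma jackson_residual_le (K : nat) (y0 : S) :
  jackson_residual K y0
    <= (1 + contraction) ^+ 2 / ((jackson_N K)%:R ^+ 2 * s) * rs_d0 y0.
Proof.
set C := _ / _.
have C_ge0 : 0 <= C by rewrite divr_ge0 ?sqr_ge0 // mulr_ge0 ?sqr_ge0 // ltW.
rewrite rs_d0E -{1}(ger0_norm C_ge0) -normrZ.
have cont : continuous (residual L \o poly_op L (jackson_poly R K)).
  move=> x; apply: continuous_comp; last exact: residual_continuous.
  exact/poly_op_continuous/res_continuous.
apply: (acts_by_le (residual L \o poly_op L (jackson_poly R K)) (GRing.scale C)
  _ _ _ (scale_acts_by C) _ cont (scale_continuous C)).
- by move=> i z /=; rewrite poly_op_acts_by residual_acts_by mulrA.
- by move=> i; rewrite normc_real ger0_norm //; exact: jackson_multiplier_le.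
Qed.

End PositiveFloor.
End RotationSpectrum.

(** * Degree and normalisation of the kernel *)

Lemma jackson_N_gt0 (K : nat) : (0 < jackson_N K)%N.
Proof. by rewrite divn_gt0 // addn2. Qed.

(** Equality holds exactly for odd [K]. Squared, this turns the constant 4 into 16. *)
Lemma jackson_N_ge (K : nat) : (K.+1 <= 2 * jackson_N K)%N.
Proof. rewrite /jackson_N; lia. Qed.

Lemma size_jackson_poly (R : realType) (K : nat) :
  size (jackson_poly R K) = (2 * jackson_N K - 2).+1%N.
Proof.
have := jackson_N_gt0 K; rewrite /jackson_poly; move: (jackson_N K) => N N_gt0.
have NV : N%:R^-1 != 0 :> R by rewrite invr_eq0 pnatr_eq0 -lt0n.
have sz : size (\sum_(j < N) 'X^j : {poly R}) = N.
  (* In this form the size is read off from the leading coefficient 1. *)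
  have -> : \sum_(j < N) 'X^j = \poly_(j < N) 1 :> {poly R}.
    by rewrite poly_def; apply: eq_bigr => j _; rewrite scale1r.
  by rewrite -[N]prednK // size_poly_eq // oner_eq0.
have p0 : N%:R^-1 *: (\sum_(j < N) 'X^j : {poly R}) != 0.
  by rewrite scaler_eq0 negb_or NV -size_poly_gt0 sz.
have := size_exp (N%:R^-1 *: (\sum_(j < N) 'X^j : {poly R})) 2.
rewrite size_scale // sz => szE.
(* [size_exp] only gives the predecessor of the size, so the square must be known to be nonzero. *)
by rewrite -[LHS]prednK ?szE ?size_poly_gt0 ?expf_neq0 //; lia.
Qed.

Lemma jackson_poly1 (R : realType) (K : nat) : (jackson_poly R K).[1] = 1.
Proof.
rewrite /jackson_poly horner_exp hornerZ horner_sum.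
under eq_bigr do rewrite hornerXn expr1n.
rewrite sumr_const card_ord mulVf ?expr1n //.
by rewrite pnatr_eq0 -lt0n jackson_N_gt0.
Qed.

(** * Rates in terms of [N] and [K] *)

Section Bounds.
Variables (R : realType) (S : rotation_spectrum R).
Local Notation s := (rs_floor S).
Hypothesis s_gt0 : 0 < s.

Lemma contraction_factor_lt4 : (1 + contraction R S) ^+ 2 < 4.
Proof.
have := contraction_lt1 _ _ s_gt0; have : 0 <= contraction R S := sqrtr_ge0 _.
by move=> ? ?; rewrite expr2; nra.
Qed.

Lemma jackson_denom_gt0 (K : nat) : 0 < (jackson_N K)%:R ^+ 2 * s.
Proof. by rewrite mulr_gt0 // exprn_gt0 // ltr0n jackson_N_gt0. Qed.

Lemma rs_d0_ge0 (y0 : S) : 0 <= rs_d0 y0.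
Proof. by rewrite rs_d0E. Qed.

Lemma jackson_rate (K : nat) (y0 : S) :
  jackson_residual K y0 <= 4 * rs_d0 y0 / ((jackson_N K)%:R ^+ 2 * s).
Proof.
apply: (le_trans (jackson_residual_le _ _ s_gt0 K y0)).
rewrite mulrAC ler_wpM2r ?invr_ge0 ?(ltW (jackson_denom_gt0 K)) //.
by rewrite ler_wpM2r ?rs_d0_ge0 // ltW // contraction_factor_lt4.
Qed.

Lemma jackson_rate_lt (K : nat) (y0 : S) : 0 < rs_d0 y0 ->
  jackson_residual K y0 < 4 * rs_d0 y0 / ((jackson_N K)%:R ^+ 2 * s).
Proof.
move=> d_gt0; apply: (le_lt_trans (jackson_residual_le _ _ s_gt0 K y0)).
rewrite mulrAC ltr_pM2r ?invr_gt0 ?jackson_denom_gt0 //.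
by rewrite ltr_pM2r // contraction_factor_lt4.
Qed.

Lemma jackson_N_to_K (K : nat) (d : R) : 0 <= d ->
  4 * d / ((jackson_N K)%:R ^+ 2 * s) <= 16 * d / (K.+1%:R ^+ 2 * s).
Proof.
move=> d_ge0.
rewrite ler_pdivrMr ?jackson_denom_gt0 // mulrAC ler_pdivlMr; last first.
  by rewrite mulr_gt0 // exprn_gt0.
have KN : K.+1%:R ^+ 2 <= 4 * (jackson_N K)%:R ^+ 2 :> R.
  have := jackson_N_ge K; rewrite -(ler_nat R) natrM => KN.
  have -> : 4 = 2 ^+ 2 :> R by rewrite -natrX.
  by rewrite -exprMn ler_sqr ?nnegrE ?mulr_ge0.
have := ler_wpM2l (mulr_ge0 d_ge0 (ltW s_gt0)) KN; lra.
Qed.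

End Bounds.

(** The ratio of the residual to [d0 / K] is at most [16 / (s K)]. The space and the point vary with
    [n] as well, so the floor may tend to 0. *)
Lemma jackson_littleo (R : realType) (S : nat -> rotation_spectrum R)
    (K : nat -> nat) (y0 : forall n, S n) :
    (fun n => rs_floor (S n) * (K n)%:R) @ \oo --> +oo ->
  (fun n => jackson_residual (K n) (y0 n))
    =o_\oo (fun n => rs_d0 (y0 n) / (K n)%:R).
Proof.
move=> /cvgryPgt sK; apply/eqoP => e e_gt0.
near=> n.
have sK0 : 0 < rs_floor (S n) * (K n)%:R by near: n; exact: sK.
have sKe : 16 / e < rs_floor (S n) * (K n)%:R by near: n; exact: sK.
(* Positivity of the product [s K] yields that of [K], a natural number, and then that of [s]. *)
have K_gt0 : 0 < (K n)%:R :> R.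
  by rewrite lt0r ler0n andbT; apply: contraTneq sK0 => ->; rewrite mulr0 ltxx.
have s_gt0 : 0 < rs_floor (S n) by rewrite -(pmulr_lgt0 _ K_gt0).
have d_ge0 := rs_d0_ge0 _ _ s_gt0 (y0 n).
rewrite ger0_norm ?normr_ge0 // ger0_norm ?divr_ge0 ?(ltW K_gt0) //.
apply: (le_trans (jackson_rate _ _ s_gt0 _ _)).
apply: (le_trans (jackson_N_to_K _ _ s_gt0 _ _ d_ge0)).
move: sKe; rewrite ltr_pdivrMr // => sKe.
rewrite ler_pdivrMr; last by rewrite mulr_gt0 ?exprn_gt0.
set s := rs_floor _ in sKe s_gt0 *; set d := rs_d0 _ in d_ge0 *.
set k : R := (K n)%:R in sKe K_gt0 *.
have -> : (K n).+1%:R = k + 1 :> R by rewrite -natr1.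
(* Regrouped so that the factors compare separately: [s k e] exceeds 16, and [(k + 1)^2 / k^2] is at
   least 1. *)
have -> : e * (d / k) * ((k + 1) ^+ 2 * s) =
    d * (s * k * e) * ((k + 1) ^+ 2 / k ^+ 2).
  by field; rewrite gt_eqF.
have -> : 16 * d = d * 16 * 1 by ring.
rewrite ler_pM ?mulr_ge0 // ?ler_wpM2l ?(ltW sKe) //.
by rewrite ler_pdivlMr ?exprn_gt0 // mul1r ler_sqr ?nnegrE; lra.
Unshelve. all: by end_near.
Qed.

Theorem theorem5p1 (R : realType) :
  (forall K : nat,
     [/\ size (jackson_poly R K) = (2 * jackson_N K - 2).+1%N,
         (2 * jackson_N K - 2 <= K)%N &
         (jackson_poly R K).[1] = 1])
  /\ (forall (S : rotation_spectrum R) (K : nat) (y0 : S),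
     0 < rs_floor S ->
     jackson_residual K y0
       <= 4 * rs_d0 y0 / ((jackson_N K)%:R ^+ 2 * rs_floor S)
       <= 16 * rs_d0 y0 / (K.+1%:R ^+ 2 * rs_floor S))
  /\ (forall (S : nat -> rotation_spectrum R) (K : nat -> nat)
        (y0 : forall n, S n),
     (fun n => rs_floor (S n) * (K n)%:R) @ \oo --> +oo ->
     (fun n => jackson_residual (K n) (y0 n))
       =o_\oo (fun n => rs_d0 (y0 n) / (K n)%:R))
  /\ (forall (S : rotation_spectrum R) (K : nat) (y0 : S),
     16 / K.+1%:R <= rs_floor S -> 0 < rs_d0 y0 ->
     16 * rs_d0 y0 / (K.+1%:R ^+ 2 * rs_floor S)
       <= universal_envelope K (rs_d0 y0)
     /\ jackson_residual K y0 < universal_envelope K (rs_d0 y0)).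
Proof.
split; [|split; [|split]].
- move=> K; split; [exact: size_jackson_poly | | exact: jackson_poly1].
  by rewrite /jackson_N; lia.
- move=> S K y0 s_gt0; rewrite jackson_rate //.
  by rewrite jackson_N_to_K // rs_d0_ge0.
- exact: jackson_littleo.
- move=> S K y0 sK d_gt0.
  have s_gt0 : 0 < rs_floor S by apply: lt_le_trans sK; rewrite divr_gt0.
  (* After cancelling [d0 / (K + 1)] this is [16 <= s (K + 1)]. *)
  have env : 16 * rs_d0 y0 / (K.+1%:R ^+ 2 * rs_floor S)
      <= universal_envelope K (rs_d0 y0).
    move: sK; rewrite /universal_envelope ler_pdivrMr ?ltr0n // => sK.
    rewrite ler_pdivrMr; last by rewrite mulr_gt0 ?exprn_gt0 ?ltr0n.
    have -> : rs_d0 y0 / K.+1%:R * (K.+1%:R ^+ 2 * rs_floor S) =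
        rs_floor S * K.+1%:R * rs_d0 y0.
      have := ltr0Sn R K; move: K.+1%:R => k k_gt0.
      by field; rewrite gt_eqF.
    by rewrite ler_wpM2r // ltW.
  split=> //; apply: lt_le_trans env.
  (* Strictness has to enter here, because the envelope comparison is an equality when
     [s = 16 / (K + 1)]. *)
  apply: lt_le_trans (jackson_rate_lt _ _ s_gt0 _ _ d_gt0) _.
  exact/jackson_N_to_K/ltW.
Qed.
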